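(* Let $S$ be a regular ruled surface in $E^3$ with conical curvature $\kappa$. If $S$ is a Darboux slant ruled surface, then $\kappa$ is constant.
   Context: $E^3$ is Euclidean 3-space with inner product $\langle\cdot,\cdot\rangle$. A regular ruled surface $S$ is given by a smooth parametrization $\vec r(s,v)=\vec c(s)+v\,\vec q(s)$ with $\|\vec q(s)\|=1$, $s$ in an open interval, where $\vec c$ is the striction curve of $S$ (for a ruled surface $\vec f(u)+v\vec q(u)$ the striction curve is $\vec c=\vec f-\frac{\langle\dot{\vec q},\dot{\vec f}\rangle}{\langle\dot{\vec q},\dot{\vec q}\rangle}\vec q$) and $s$ is the arc length parameter of $\vec c$. The derivative $\dot{\vec q}$ is nowhere zero, so that the following frame is defined. The central tangent is $\vec a=\frac{\vec q\times\dot{\vec q}}{\|\dot{\vec q}\|}$ and the central normal is $\vec h=\vec a\times\vec q$; the orthonormal system $\{\vec q,\vec h,\vec a\}$ is the Frenet frame of $S$. The unit vectors $\vec q$ trace a curve on the unit sphere, the spherical image of $S$, whose arc length is denoted $s_1$. With respect to $s_1$ the Frenet formulae hold: $$\frac{d\vec q}{ds_1}=\vec h,\qquad \frac{d\vec h}{ds_1}=-\vec q+\kappa\vec a,\qquad \frac{d\vec a}{ds_1}=-\kappa\vec h,$$ and the function $\kappa$ is called the conical curvature of $S$. The Darboux vector of $S$ is $\vec W=\kappa\vec q+\vec a$. $S$ is called a Darboux slant ruled surface if there is a fixed non-zero vector $\vec u$ such that $\langle\vec W,\vec u\rangle$ is constant (the constant value is written $\cos\varphi$). *)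

(* Defs.v *)
From HB Require Import structures.
From mathcomp Require Import all_boot all_order all_algebra.
From mathcomp Require Import all_classical all_reals all_analysis.
Set Implicit Arguments.
Unset Strict Implicit.
Unset Printing Implicit Defensive.
Import Order.TTheory GRing.Theory Num.Theory.
Import numFieldNormedType.Exports.
Local Open Scope classical_set_scope.
Local Open Scope ring_scope.

(* E^3 is 'rV[R]_3.  Its library norm `|u| is the sup norm, so the Euclidean
   norm is defined here; both induce the same topology, hence the same
   limits and derivatives. *)

Definition dot {R : realType} (u v : 'rV[R]_3) : R :=
  \sum_(k < 3) u 0 k * v 0 k.

Definition enorm {R : realType} (u : 'rV[R]_3) : R := Num.sqrt (dot u u).

(* The indices k + 1 and k + 2 are taken in 'I_3, i.e. modulo 3. *)
Definition cross {R : realType} (u v : 'rV[R]_3) : 'rV[R]_3 :=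
  \row_(k < 3) (u 0 (k + 1) * v 0 (k + 2%:R) - u 0 (k + 2%:R) * v 0 (k + 1)).

Definition open_interval {R : realType} (I : set R) : Prop :=
  [/\ open I, is_interval I & I !=set0].

Definition smooth_on {R : realType} (I : set R) (f : R -> 'rV[R]_3) : Prop :=
  forall (n : nat) (s : R), I s -> derivable (derive1n n f) s 1.

Definition ruled_param {R : realType} (f q : R -> 'rV[R]_3) (s v : R) :
  'rV[R]_3 := f s + v *: q s.

Definition striction_curve {R : realType} (f q : R -> 'rV[R]_3) (s : R) :
  'rV[R]_3 :=
  f s -
  (dot (derive1 q s) (derive1 f s) / dot (derive1 q s) (derive1 q s)) *: q s.

(* The surface is the patch (s, v) in I x J of r(s, v) = c(s) + v q(s); with
   J not containing 0, tangent developables, which are singular along their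
   striction curve v = 0, are covered too. *)
Record regular_ruled_surface {R : realType} (I J : set R)
    (c q : R -> 'rV[R]_3) : Prop := RegularRuledSurface {
  rrs_dom_s : open_interval I;
  rrs_dom_v : open_interval J;
  rrs_smooth_c : smooth_on I c;
  rrs_smooth_q : smooth_on I q;
  rrs_unit : forall s, I s -> enorm (q s) = 1;
  rrs_regular : forall s v, I s -> J v ->
    cross (derive1 (fun t => ruled_param c q t v) s)
          (derive1 (fun w => ruled_param c q s w) v) != 0;
  rrs_noncylindrical : forall s, I s -> derive1 q s != 0;
  rrs_striction : forall s, I s -> c s = striction_curve c q s;
  rrs_arc_length : forall s, I s -> enorm (derive1 c s) = 1 }.

Definition central_tangent {R : realType} (q : R -> 'rV[R]_3) (s : R) :
  'rV[R]_3 := (enorm (derive1 q s))^-1 *: cross (q s) (derive1 q s).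

Definition central_normal {R : realType} (q : R -> 'rV[R]_3) (s : R) :
  'rV[R]_3 := cross (central_tangent q s) (q s).

(* An arc length function is determined up to an additive constant, the
   choice of the point of I from which lengths are measured. *)
Definition arc_length_on {R : realType} (I : set R) (f : R -> 'rV[R]_3)
    (s1 : R -> R) : Prop :=
  forall x y, I x -> I y -> x <= y ->
    s1 y - s1 x = \int[lebesgue_measure]_(t in `[x, y]) enorm (derive1 f t).

(* dX/ds1 = L at the parameter value s, as the limit of difference quotients
   of X with respect to s1. *)
Definition is_derive_wrt {R : realType} (s1 : R -> R) (X : R -> 'rV[R]_3)
    (s : R) (L : 'rV[R]_3) : Prop :=
  (s1 t - s1 s)^-1 *: (X t - X s) @[t --> s^'] --> L.

(* The Frenet formulae with respect to s1; they determine kappa on I. *)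
Definition is_conical_curvature {R : realType} (I : set R)
    (q : R -> 'rV[R]_3) (s1 kappa : R -> R) : Prop :=
  forall s, I s ->
    [/\ is_derive_wrt s1 q s (central_normal q s),
        is_derive_wrt s1 (central_normal q) s
          (- q s + kappa s *: central_tangent q s)
      & is_derive_wrt s1 (central_tangent q) s
          (- kappa s *: central_normal q s)].

Definition darboux_vector {R : realType} (q : R -> 'rV[R]_3)
    (kappa : R -> R) (s : R) : 'rV[R]_3 :=
  kappa s *: q s + central_tangent q s.

Definition darboux_slant {R : realType} (I : set R) (q : R -> 'rV[R]_3)
    (kappa : R -> R) : Prop :=
  exists u : 'rV[R]_3, u != 0 /\
    exists b : R, forall s, I s -> dot (darboux_vector q kappa s) u = b.

(* Main.v *)
Require Import Defs.
From mathcomp Require Import all_boot all_order all_algebra.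
From mathcomp Require Import all_classical all_reals all_analysis.
From mathcomp Require Import ring lra.

(**
Let [u] be the fixed vector and put [x = <q,u>], [y = <h,u>], [z = <a,u>], and
[g = |q'| = ds1/ds].  The Frenet formulae read
    [x' = g y],   [y' = g (kappa z - x)],   [z' = - g kappa y],
and the slant condition reads [kappa x + z = b].

Wherever [x <> 0], the curvature is [kappa = (b - z) / x], hence it is
differentiable there, with [kappa' = (g kappa y x - (b - z) g y) / x^2 = 0]
([curvature_deriv0]).  So the whole matter is the zeros of [x].  They cannot be
avoided: if [u] is a multiple of [a] and [kappa = 0], then [x] vanishes
identically.  But they are isolated wherever [kappa <> 0] ([zeros_isolated]):
at a zero of [x], either [y <> 0] and the zero is simple, or [y = 0], and then
[z <> 0] because [u <> 0], so that [y' = g kappa z <> 0] and [x' = g y] is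
non-zero on both sides.  Therefore [kappa], being continuous, is constant near
each point where it is non-zero ([curvature_locally_constant]).  If [kappa]
takes a value [k <> 0], then the set where it equals [k] is non-empty, open and
closed in the interval, hence everything; otherwise [kappa = 0]
([curvature_constant]).

The continuity of [kappa] comes from the smoothness of [q] through
[kappa = <q'',a> / |q'|^2], the derivative of [<q',a> = 0] ([curvatureE]).
The Frenet formulae are limits of difference quotients taken with respect to
[s1]; [arc_length_derive] and [is_derive_of_wrt] turn them into derivatives in
[s].
*)

Set Implicit Arguments.
Unset Strict Implicit.
Unset Printing Implicit Defensive.
Import Order.TTheory GRing.Theory Num.Theory.
Import numFieldNormedType.Exports.
Local Open Scope classical_set_scope.
Local Open Scope ring_scope.

(** * One-variable calculus around a point *)

Lemma is_derive_continuous (R : realType) (f : R -> R) (s d : R) :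
  is_derive s 1 f d -> {for s, continuous f}.
Proof.
by move=> [df _]; apply/differentiable_continuous/derivable1_diffP.
Qed.

Lemma near_neq0 (R : realType) (f : R -> R) (s : R) :
  {for s, continuous f} -> f s != 0 -> \forall t \near s, f t != 0.
Proof.
move=> cf fs0; exact: (cvgr_neq0 _ cf fs0).
Qed.

(** A two-sided mean value theorem at [s] in the language of neighbourhoods.  Only
continuity is asked at [s] itself, and the predicate [P] carries to the
intermediate point whatever is known of the points near [s]. *)
Lemma MVT_near (R : realType) (f df : R -> R) (P : R -> Prop) (s : R) :
  {for s, continuous f} ->
  (\forall r \near s^', is_derive (r : R) 1 f (df r) /\ P r) ->
  \forall t \near s^', exists2 c, P c & f t - f s = df c * (t - s).
Proof.
move=> cf; rewrite /dnbhs /within/= => /nbhs_ballP[e /= e0 He].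
apply/nbhs_ballP; exists e => //= t; rewrite -ball_normE/= => st nts.
have H r : (s < r <= t) || (t <= r < s) -> is_derive r 1 f (df r) /\ P r.
  move=> hr; apply: He; last by apply/eqP => E; move: hr; rewrite E !ltxx !andbF.
  rewrite -ball_normE/=; move: st; rewrite !ltr_norml.
  by case/orP: hr; lra.
have C r : (s <= r <= t) || (t <= r <= s) -> {for r, continuous f}.
  have [-> //|rs] := eqVneq r s.
  move=> hr; apply: (@is_derive_continuous _ _ _ (df r)); apply H.
  by rewrite !lt_neqAle rs eq_sym rs.
have [ts|ts|ts] := ltgtP s t; last by rewrite ts eqxx in nts.
- have [||c cst E] := @MVT R f df s t ts.
  + by move=> r; rewrite in_itv/= => /andP[? ?]; apply H; apply/orP; left; lra.
  + apply: continuous_in_subspaceT => r; rewrite inE/= in_itv/= => ?.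
    by apply: C; apply/orP; left.
  exists c => //; apply H; apply/orP; left.
  by move: cst; rewrite in_itv/= => /andP[-> /ltW ->].
- have [||c cst E] := @MVT R f df t s ts.
  + by move=> r; rewrite in_itv/= => /andP[? ?]; apply H; apply/orP; right; lra.
  + apply: continuous_in_subspaceT => r; rewrite inE/= in_itv/= => ?.
    by apply: C; apply/orP; right.
  exists c; last lra.
  apply H; apply/orP; right.
  by move: cst; rewrite in_itv/= => /andP[/ltW -> ->].
Qed.

(** Caratheodory: [f t - f s = g t (t - s)] with [g] continuous and [g s = d]. *)
Lemma derive_neq0_near (R : realType) (f : R -> R) (s d : R) :
  is_derive s 1 f d -> d != 0 -> \forall t \near s^', f t != f s.
Proof.
move=> /is_derive1_caratheodory[g [fg cg <-]] gs0.
have gn := nbhs_dnbhs (near_neq0 cg gs0).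
near=> t; rewrite -subr_eq0 fg mulf_neq0 ?subr_eq0//; near: t => //.
exact: nbhs_dnbhs_neq.
Unshelve. all: by end_near. Qed.

(** * The differential system of a Darboux slant surface *)

Section ode.
Context {R : realType} {I : set R} {g x y z k : R -> R} {b : R}.
Hypotheses (oI : open I) (itvI : is_interval I).
Hypothesis g_neq0 : forall s, I s -> g s != 0.
Hypothesis dx : forall s, I s -> is_derive s 1 x (g s * y s).
Hypothesis dy : forall s, I s -> is_derive s 1 y (g s * (k s * z s - x s)).
Hypothesis dz : forall s, I s -> is_derive s 1 z (- (g s * k s * y s)).
Hypothesis ck : forall s, I s -> {for s, continuous k}.
Hypothesis kxz : forall s, I s -> k s * x s + z s = b.
Hypothesis nz : forall s, I s -> x s = 0 -> y s = 0 -> z s != 0.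

Let nearI s : I s -> \forall t \near s, I t.
Proof. by move=> Is; apply: open_nbhs_nbhs; split. Qed.

(** A double zero of [x] is still isolated: there [y' <> 0], so [x' = g y] does not
vanish on either side. *)
Lemma zeros_isolated s : I s -> k s != 0 -> \forall t \near s^', x t != 0.
Proof.
move=> Is ks0.
have [xs0|xs0] := eqVneq (x s) 0; last first.
  exact/nbhs_dnbhs/(near_neq0 (is_derive_continuous (dx Is))).
have [ys0|ys0] := eqVneq (y s) 0; last first.
  by have := derive_neq0_near (dx Is) (mulf_neq0 (g_neq0 Is) ys0); rewrite xs0.
have y'0 : g s * (k s * z s - x s) != 0.
  by rewrite xs0 subr0 !mulf_neq0 ?g_neq0 ?nz.
have yn := derive_neq0_near (dy Is) y'0; rewrite ys0 in yn.
have In := nbhs_dnbhs (nearI Is).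
have xn : \forall t \near s^',
    exists2 c, g c * y c != 0 & x t - x s = g c * y c * (t - s).
  apply: (@MVT_near _ x (fun r => g r * y r) (fun r => g r * y r != 0)).
    exact: is_derive_continuous (dx Is).
  near=> r; have Ir : I r by near: r.
  by split; [exact: dx|rewrite mulf_neq0 ?g_neq0//; near: r].
near=> t.
have [c c0] : exists2 c, g c * y c != 0 & x t - x s = g c * y c * (t - s)
  by near: t.
rewrite xs0 subr0 => ->; rewrite mulf_neq0// subr_eq0.
by near: t; exact: nbhs_dnbhs_neq.
Unshelve. all: by end_near. Qed.

(** In terms of vectors, [W' = kappa' q], so that a constant [<W,u>] forces
[kappa' <q,u> = 0]; solving the relation for [k] spares assuming that [k] is
differentiable. *)
Lemma curvature_deriv0 s : I s -> x s != 0 -> is_derive s 1 k 0.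
Proof.
move=> Is xs0.
apply: (@near_eq_is_derive _ _ _ (fun t => (b - z t) * (x t)^-1)).
  have := near_neq0 (is_derive_continuous (dx Is)) xs0.
  have := nearI Is; apply: filterS2 => t It xt0.
  by rewrite -(kxz It) addrK mulfK.
have E : 0 = (b - z s) *: (- (x s) ^- 2 *: (g s * y s)) +
   (x s)^-1 *: (0 - - (g s * k s * y s)).
  rewrite /GRing.scale/= -(kxz Is); field; exact: xs0.
rewrite {1}E.
exact: (is_deriveM (is_deriveB (is_derive_cst b s 1) (dz Is)) (is_deriveV xs0 (dx Is))).
Qed.

Lemma curvature_locally_constant s : I s -> k s != 0 ->
  \forall t \near s, k t = k s.
Proof.
move=> Is ks0.
have xn := zeros_isolated Is ks0; have In := nbhs_dnbhs (nearI Is).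
have : \forall t \near s^', exists2 c : R, True & k t - k s = 0 * (t - s).
  apply: (@MVT_near _ k (fun=> 0) (fun=> True)); first exact: ck.
  near=> r; split=> //.
  by apply: curvature_deriv0; near: r.
rewrite /dnbhs /within/= => kn; near=> t.
have [->//|ts] := eqVneq t s.
have [c _] : exists2 c : R, True & k t - k s = 0 * (t - s).
  by move: ts; near: t.
by rewrite mul0r => /eqP; rewrite subr_eq0 => /eqP.
Unshelve. all: by end_near. Qed.

(** The hypothesis [k s <> 0] of local constancy prevents a direct appeal to
connectedness; it is enough to look at one non-zero value. *)
Lemma curvature_constant : exists c, forall s, I s -> k s = c.
Proof.
have [[s0 Is0 ks0]|nk] := pselect (exists2 s, I s & k s != 0); last first.
  exists 0 => s Is; apply: contrapT => /eqP ks; apply: nk; by exists s.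
exists (k s0); set B := I `&` [set s | k s = k s0].
suff -> : I = B by move=> s [].
apply/esym; have /connected_intervalP cI := itvI.
apply: cI.
- by exists s0.
- exists B; last by rewrite /B setIA setIid.
  rewrite openE => s [Is /= ks]; rewrite /interior.
  have kn0 : k s != 0 by rewrite ks.
  have := curvature_locally_constant Is kn0.
  have := nearI Is; apply: filterS2 => t It kt; split=> //=; by rewrite kt.
- exists (closure B); first exact: closed_closure.
  apply/seteqP; split=> s; first by move=> Bs; split; [case: Bs|exact: subset_closure].
  move=> [Is cB]; split=> //=; apply: contrapT => /eqP kne.
  have : \forall t \near s, k t - k s0 != 0.
    apply: (@near_neq0 _ (fun t => k t - k s0)); last by rewrite subr_eq0.
    by apply: continuousB; [exact: ck|exact: cst_continuous].
  by move=> /cB[t [[_ /= ->]]]; rewrite subrr eqxx.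
Qed.

End ode.

(** * Inner and cross products in three dimensions *)

Section inner_product.
Context {R : realType}.
Implicit Types u v w : 'rV[R]_3.

(** The sum is unrolled by [big_ord_recl] into lifts, whereas [cross] shifts
indices by addition modulo 3; [0], [1], [1 + 1] is the common form. *)
Lemma ord3E : (lift ord0 ord0 = 1 :> 'I_3) * (lift ord0 (lift ord0 ord0) = 1 + 1 :> 'I_3).
Proof. by split; apply: val_inj. Qed.

Lemma dotE u v :
  dot u v = u 0 0 * v 0 0 + u 0 1 * v 0 1 + u 0 (1 + 1) * v 0 (1 + 1).
Proof. by rewrite /dot !big_ord_recl big_ord0 !ord3E addr0 addrA. Qed.

Lemma crossE u v :
  (cross u v 0 0 = u 0 1 * v 0 (1 + 1) - u 0 (1 + 1) * v 0 1) *
  (cross u v 0 1 = u 0 (1 + 1) * v 0 0 - u 0 0 * v 0 (1 + 1)) *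
  (cross u v 0 (1 + 1) = u 0 0 * v 0 1 - u 0 1 * v 0 0).
Proof.
by rewrite /cross !mxE; do !split; congr (u 0 _ * v 0 _ - u 0 _ * v 0 _);
  apply: val_inj.
Qed.

Lemma dotC u v : dot u v = dot v u.
Proof. by apply: eq_bigr => k _; rewrite mulrC. Qed.

Lemma dotDl u v w : dot (u + v) w = dot u w + dot v w.
Proof. by rewrite !dotE !mxE; ring. Qed.

Lemma dotZl a u v : dot (a *: u) v = a * dot u v.
Proof. by rewrite !dotE !mxE; ring. Qed.

Lemma dotNl u v : dot (- u) v = - dot u v.
Proof. by rewrite -scaleN1r dotZl mulN1r. Qed.

Lemma dotZr a u v : dot u (a *: v) = a * dot u v.
Proof. by rewrite dotC dotZl dotC. Qed.

Lemma dot0r u : dot u 0 = 0.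
Proof. by rewrite -(scale0r 0) dotZr mul0r. Qed.

Lemma dot_ge0 u : 0 <= dot u u.
Proof. by apply: sumr_ge0 => k _; rewrite -expr2 sqr_ge0. Qed.

Lemma dot_eq0 u : dot u u = 0 -> u = 0.
Proof.
move/eqP; rewrite psumr_eq0 => [/allP u0|k _]; last by rewrite -expr2 sqr_ge0.
apply/rowP => k; have /= := u0 k (mem_index_enum k).
by rewrite mulf_eq0 orbb mxE => /eqP.
Qed.

Lemma enorm_eq0 u : enorm u = 0 -> u = 0.
Proof.
move=> /eqP; rewrite sqrtr_eq0 => u0; apply: dot_eq0; apply/eqP.
by rewrite eq_le u0 dot_ge0.
Qed.

Lemma dot_crossr u v : dot v (cross u v) = 0.
Proof. by rewrite dotE !crossE; ring. Qed.

(** The square of a determinant is the Gram determinant. *)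
Lemma gram_det u v w : dot u (cross v w) ^+ 2 =
  dot u u * (dot v v * dot w w - dot v w ^+ 2)
  - dot u v * (dot u v * dot w w - dot v w * dot u w)
  + dot u w * (dot u v * dot v w - dot v v * dot u w).
Proof. by rewrite !dotE !crossE; ring. Qed.

(** The Gram determinant of [u], [v], [w] reduces here to [|u|^2 |v|^2 |w|^2]. *)
Lemma orthogonal_basis_eq0 u v w : v != 0 -> w != 0 -> dot v w = 0 ->
  dot u v = 0 -> dot u w = 0 -> dot u (cross v w) = 0 -> u = 0.
Proof.
move=> v0 w0 vw uv uw uvw; have := gram_det u v w.
rewrite uvw vw uv uw expr0n /= !(mul0r, mulr0, subr0, addr0) => /esym/eqP.
rewrite !mulf_eq0 => /or3P[/eqP/dot_eq0//|/eqP/dot_eq0 E|/eqP/dot_eq0 E].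
  by rewrite E eqxx in v0.
by rewrite E eqxx in w0.
Qed.

End inner_product.

(** * Derivatives of vector functions *)

Section calculus.
Context {R : realType}.
Implicit Types X Y : R -> 'rV[R]_3.

Lemma is_derive_entry X (s : R) dX (k : 'I_3) :
  is_derive s 1 X dX -> is_derive s 1 (fun t => X t 0 k) (dX 0 k).
Proof.
move=> [Xs <-]; split; first by have /derivable_mxP := Xs; exact.
by rewrite derive_mx// mxE.
Qed.

Lemma is_derive_dot X Y (s : R) dX dY :
  is_derive s 1 X dX -> is_derive s 1 Y dY ->
  is_derive s 1 (fun t => dot (X t) (Y t)) (dot dX (Y s) + dot (X s) dY).
Proof.
move=> dXs dYs.
have H k := is_deriveM (is_derive_entry k dXs) (is_derive_entry k dYs).
have := is_deriveD (is_deriveD (H 0) (H 1)) (H (1 + 1)).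
congr is_derive; first by apply/funext => t; rewrite dotE.
rewrite !dotE /GRing.scale/=; ring.
Qed.

Lemma is_derive_dotl X (s : R) dX u :
  is_derive s 1 X dX -> is_derive s 1 (fun t => dot (X t) u) (dot dX u).
Proof.
move=> dXs; have := is_derive_dot dXs (is_derive_cst u s 1).
by rewrite dot0r addr0.
Qed.

Lemma derivable_vec_continuous X (s : R) : derivable X s 1 -> {for s, continuous X}.
Proof. by move=> dX; apply/differentiable_continuous/derivable1_diffP. Qed.

Lemma continuous_dot X Y (s : R) : {for s, continuous X} -> {for s, continuous Y} ->
  {for s, continuous (fun t => dot (X t) (Y t))}.
Proof.
move=> cX cY.
have H (Z : R -> 'rV[R]_3) (k : 'I_3) :
    {for s, continuous Z} -> {for s, continuous (fun t => Z t 0 k)}.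
  move=> cZ; apply: (@continuous_comp _ _ _ Z (fun v : 'rV[R]_3 => v 0 k)) => //.
  exact: coord_continuous.
have -> : (fun t => dot (X t) (Y t)) = (fun t =>
  X t 0 0 * Y t 0 0 + X t 0 1 * Y t 0 1 + X t 0 (1 + 1) * Y t 0 (1 + 1)).
  by apply/funext => t; rewrite dotE.
by apply: continuousD; first apply: continuousD; apply: continuousM; exact: H.
Qed.

Lemma shift_dnbhs (s : R) : h + s @[h --> 0^'] --> s^'.
Proof.
move=> A; rewrite /dnbhs /within/= => /nbhs_ballP[e /= e0 He].
apply/nbhs_ballP; exists e => //= h; rewrite -ball_normE/= sub0r normrN => he h0.
apply: He; last by rewrite -subr_eq0 addrK.
by rewrite -ball_normE/= opprD addrCA subrr addr0 normrN.
Qed.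

(** The chain rule: the quotient of [X] in [s] is the quotient of [s1] times the
quotient of [X] with respect to [s1].  As [g <> 0], the denominators
[s1 t - s1 s] do not vanish for [t] near [s]. *)
Lemma is_derive_of_wrt s1 X (s g : R) L :
  is_derive s 1 s1 g -> g != 0 -> is_derive_wrt s1 X s L ->
  is_derive s 1 X (g *: L).
Proof.
move=> ds1 g0 XL.
have s1n : \forall h \near (0 : R)^', s1 (h + s) != s1 s :=
  shift_dnbhs (derive_neq0_near ds1 g0).
have ds1' : h^-1 * (s1 (h + s) - s1 s) @[h --> (0 : R)^'] --> g.
  have [] := ds1; rewrite /derivable /derive => /cvgP + <-.
  by under eq_fun do rewrite /= [_ *: 1]mulr1.
have XL' : (s1 (h + s) - s1 s)^-1 *: (X (h + s) - X s) @[h --> (0 : R)^'] --> L.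
  exact: (cvg_comp _ _ (@shift_dnbhs s) XL).
have dX : h^-1 *: ((X \o shift s) (h *: (1 : R)) - X s) @[h --> (0 : R)^'] --> g *: L.
  have := @cvgZ _ _ _ _ (dnbhs_filter (0 : R)) _ _ _ _ ds1' XL'; apply: cvg_trans.
  apply: (@near_eq_cvg _ _ _ (dnbhs_filter _)).
  apply: filterS s1n => h s1h /=.
  by rewrite [h *: 1]mulr1 scalerA mulfK// subr_eq0.
split; first exact: cvgP dX.
exact: cvg_lim dX.
Qed.

End calculus.

(** The fundamental theorem of calculus; lengths are measured from a point [a] of
[I] to the left of [s]. *)
Lemma arc_length_derive (R : realType) (I : set R) (f : R -> 'rV[R]_3)
    (s1 : R -> R) (s : R) :
  open I -> (forall t, I t -> {for t, continuous (derive1 f)}) ->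
  arc_length_on I f s1 -> I s -> is_derive s 1 s1 (enorm (derive1 f s)).
Proof.
move=> oI cf' len Is.
have ce t : I t -> {for t, continuous (fun t => enorm (derive1 f t))}.
  move=> It; apply: (@continuous_comp _ _ _ (fun t => dot _ _) Num.sqrt).
    by apply: continuous_dot; exact: cf'.
  exact: sqrt_continuous.
have [e /= e0 He] : nbhs_ball s I by apply/nbhs_ballP; apply: open_nbhs_nbhs; split.
have Ie r : s - e < r < s + e -> I r.
  by move=> hr; apply: He; rewrite -ball_normE/= ltr_norml; lra.
set a := s - e / 2; set u := s + e / 2.
have Ia : I a by apply: Ie; rewrite /a; lra.
have Iau t : a <= t <= u -> I t by rewrite /a /u => ?; apply: Ie; lra.
have [] := @continuous_FTC1_closed R (fun t => enorm (derive1 f t)) a s u.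
- by rewrite /u; lra.
- apply: continuous_compact_integrable; first exact: segment_compact.
  apply: continuous_in_subspaceT => t; rewrite inE/= in_itv/= => ?.
  by apply: ce; exact: Iau.
- by rewrite /a; lra.
- exact: ce.
move=> dF F's.
have dF' : is_derive s 1 (fun t : R =>
    \int[lebesgue_measure]_(r in `[a, t]) enorm (derive1 f r) + s1 a)
    (enorm (derive1 f s)).
  have := is_deriveD (DeriveDef dF (erefl _)) (is_derive_cst (s1 a) s 1).
  by rewrite -derive1E F's addr0.
apply: near_eq_is_derive dF'.
near=> t; rewrite -len ?subrK//.
- by near: t; exact: open_nbhs_nbhs.
- by apply: ltW; near: t; apply: lt_nbhsr; rewrite /a; lra.
Unshelve. all: by end_near. Qed.

(** * The Frenet frame *)

Section frenet.
Context {R : realType} {I : set R} {q : R -> 'rV[R]_3} {s1 kappa : R -> R}.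
Hypotheses (oI : open I) (smooth_q : smooth_on I q).
Hypothesis noncyl : forall s, I s -> derive1 q s != 0.
Hypothesis unit_q : forall s, I s -> enorm (q s) = 1.
Hypothesis len : arc_length_on I q s1.
Hypothesis frenet : is_conical_curvature I q s1 kappa.

Let g s := enorm (derive1 q s).
Let h := central_normal q.
Let a := central_tangent q.

Lemma speed_neq0 s : I s -> g s != 0.
Proof. by move=> Is; apply: contra (noncyl Is) => /eqP/enorm_eq0 ->. Qed.

Lemma arc_length_speed s : I s -> is_derive s 1 s1 (g s).
Proof.
apply: (arc_length_derive oI _ len) => t It.
by apply: derivable_vec_continuous; exact: (@smooth_q 1%N _ It).
Qed.

Lemma is_derive_q s : I s -> is_derive s 1 q (g s *: h s).
Proof.
move=> Is; have [H _ _] := frenet Is.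
exact: is_derive_of_wrt (arc_length_speed Is) (speed_neq0 Is) H.
Qed.

Lemma is_derive_h s : I s -> is_derive s 1 h (g s *: (- q s + kappa s *: a s)).
Proof.
move=> Is; have [_ H _] := frenet Is.
exact: is_derive_of_wrt (arc_length_speed Is) (speed_neq0 Is) H.
Qed.

Lemma is_derive_a s : I s -> is_derive s 1 a (g s *: (- kappa s *: h s)).
Proof.
move=> Is; have [_ _ H] := frenet Is.
exact: is_derive_of_wrt (arc_length_speed Is) (speed_neq0 Is) H.
Qed.

Lemma derive_q_central_normal s : I s -> derive1 q s = g s *: h s.
Proof. by move=> Is; rewrite derive1E; have [_ ->] := is_derive_q Is. Qed.

(** Differentiating [<q',a> = 0] gives [<q'',a> = g kappa <q',h>], where
[g h = q']. *)
Lemma curvatureE s : I s ->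
  kappa s = dot (derive1n 2 q s) (a s) / dot (derive1 q s) (derive1 q s).
Proof.
move=> Is.
have d0 : dot (derive1 q s) (derive1 q s) != 0.
  by apply: contra (noncyl Is) => /eqP/dot_eq0 ->.
have dq' : is_derive s 1 (derive1 q) (derive1n 2 q s).
  by apply: DeriveDef; [exact: (@smooth_q 1%N _ Is)|rewrite -derive1E].
have [_] := is_derive_dot dq' (is_derive_a Is).
have -> : (fun t => dot (derive1 q t) (a t)) = cst 0.
  by apply/funext => t; rewrite /a /central_tangent dotZr dot_crossr mulr0.
have -> : g s *: (- kappa s *: h s) = - kappa s *: derive1 q s.
  by rewrite derive_q_central_normal// !scalerA mulrC.
rewrite derive_cst (dotZr (- kappa s)) mulNr => /esym/eqP; rewrite subr_eq0 => /eqP ->.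
by rewrite mulfK.
Qed.

(** The right-hand side of [curvatureE] is continuous because [q] is smooth and
[a] is differentiable, by the third Frenet formula. *)
Lemma curvature_continuous s : I s -> {for s, continuous kappa}.
Proof.
move=> Is.
have d0 : dot (derive1 q s) (derive1 q s) != 0.
  by apply: contra (noncyl Is) => /eqP/dot_eq0 ->.
have cq' n : {for s, continuous (derive1n n q)}.
  by apply: derivable_vec_continuous; exact: smooth_q.
have ca : {for s, continuous a}.
  by apply: derivable_vec_continuous; have [] := is_derive_a Is.
have H : {for s, continuous (fun t => dot (derive1n 2 q t) (a t) /
    dot (derive1 q t) (derive1 q t))}.
  apply: continuousM; first exact: continuous_dot.
  by apply: continuousV => //; apply: continuous_dot; exact: (cq' 1%N).
suff : kappa t @[t --> s] --> kappa s by [].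
rewrite (curvatureE Is); apply: cvg_trans H; apply: near_eq_cvg.
have : \forall t \near s, I t by exact: open_nbhs_nbhs.
by apply: filterS => t /curvatureE ->.
Qed.

(** Up to positive factors, [q], [h], [a] are [q], [q'] and [q x q'], and [q] is
orthogonal to [q'] because [|q| = 1]. *)
Lemma frame_eq0 s u : I s ->
  dot (q s) u = 0 -> dot (h s) u = 0 -> dot (a s) u = 0 -> u = 0.
Proof.
move=> Is qu hu au.
have qq1 t : I t -> dot (q t) (q t) = 1.
  by move=> /unit_q q1; rewrite -(sqr_sqrtr (dot_ge0 (q t))) -/(enorm _) q1 expr1n.
have q0 : q s != 0.
  by apply/eqP => q0; have := qq1 _ Is; rewrite q0 dot0r => /esym/eqP; rewrite oner_eq0.
have qh : dot (q s) (h s) = 0.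
  have qq : \forall t \near s, 1 = dot (q t) (q t).
    have : \forall t \near s, I t by exact: open_nbhs_nbhs.
    by apply: filterS => t /qq1.
  have [_] := is_derive_dot (is_derive_q Is) (is_derive_q Is).
  have [_ ->] := near_eq_is_derive qq (is_derive_cst (1 : R) s 1).
  rewrite (dotZl (g s)) (dotZr (g s)) (dotC (h s)) -mulr2n => /esym/eqP.
  by rewrite mulrn_eq0/= mulf_eq0 (negbTE (speed_neq0 Is))/= => /eqP.
apply: (@orthogonal_basis_eq0 _ u (q s) (derive1 q s)) => //; first exact: noncyl.
- by rewrite derive_q_central_normal// dotZr qh mulr0.
- by rewrite dotC.
- by rewrite derive_q_central_normal// dotZr dotC hu mulr0.
- have : dot (a s) u = (g s)^-1 * dot (cross (q s) (derive1 q s)) u by rewrite dotZl.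
  rewrite au => /esym/eqP; rewrite mulf_eq0 invr_eq0 (negbTE (speed_neq0 Is))/=.
  by rewrite dotC => /eqP.
Qed.

End frenet.

(** * The theorem *)

Theorem theorem3p1 (R : realType) (I J : set R) (c q : R -> 'rV[R]_3)
    (s1 kappa : R -> R)
    (hS : regular_ruled_surface I J c q)
    (hs1 : arc_length_on I q s1)
    (hkappa : is_conical_curvature I q s1 kappa)
    (hslant : darboux_slant I q kappa) :
  exists k : R, forall s : R, I s -> kappa s = k.
Proof.
have [[oI itvI _] _ _ smooth_q unit_q _ noncyl _ _] := hS.
have [u [u0 [b Wu]]] := hslant.
apply: (@curvature_constant R I (fun s => enorm (derive1 q s))
  (fun s => dot (q s) u) (fun s => dot (central_normal q s) u)
  (fun s => dot (central_tangent q s) u) kappa b) => // s Is.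
- exact: (speed_neq0 noncyl Is).
- by rewrite -dotZl; apply: is_derive_dotl;
  exact: is_derive_q oI smooth_q noncyl hs1 hkappa _ Is.
- have -> : kappa s * dot (central_tangent q s) u - dot (q s) u =
      dot (- q s + kappa s *: central_tangent q s) u.
    by rewrite dotDl dotNl dotZl addrC.
  by rewrite -dotZl; apply: is_derive_dotl;
  exact: is_derive_h oI smooth_q noncyl hs1 hkappa _ Is.
- have -> : - (enorm (derive1 q s) * kappa s * dot (central_normal q s) u) =
      dot (enorm (derive1 q s) *: (- kappa s *: central_normal q s)) u.
    by rewrite (dotZl (enorm _)) (dotZl (- _)); ring.
  by apply: is_derive_dotl; exact: is_derive_a oI smooth_q noncyl hs1 hkappa _ Is.
- exact: curvature_continuous oI smooth_q noncyl hs1 hkappa _ Is.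
- by rewrite -dotZl -dotDl; exact: Wu.
- move=> qu hu; apply: contra u0 => /eqP au; apply/eqP.
  exact: frame_eq0 oI smooth_q noncyl unit_q hs1 hkappa _ _ Is qu hu au.
Qed.
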